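(* Let $n\ge 2$ and $\mathcal{D}\subseteq\binom{[n]}{2}$. The family $\mathrm{Mat}(\mathcal{D})$ of maximal (with respect to inclusion) matroids contained in $\mathcal{D}^c$ is given by $$\mathrm{Mat}(\mathcal{D})=\left\{\left(\overline{\mathcal{D}+T}\right)^c \;:\; T\in\mathbb{T}_{\mathcal{D}},\ \left(\overline{\mathcal{D}+T}\right)^c\neq\emptyset\right\}.$$
   Context: $[n]=\{1,\dots,n\}$, $\binom{[n]}{2}$ is the set of 2-element subsets of $[n]$, and complements $(\cdot)^c$ are taken in $\binom{[n]}{2}$. A matroid here is a nonempty collection $\mathcal{B}\subseteq\binom{[n]}{2}$ (the bases) satisfying the exchange axiom: for all $B_1,B_2\in\mathcal{B}$ and $b_1\in B_1\setminus B_2$ there is $b_2\in B_2\setminus B_1$ with $(B_1\setminus\{b_1\})\cup\{b_2\}\in\mathcal{B}$. $\mathrm{Mat}(\mathcal{D})$ is the set of matroids $\mathcal{M}\subseteq\mathcal{D}^c$ for which there is no matroid $\mathcal{M}'$ with $\mathcal{M}\subsetneq\mathcal{M}'\subseteq\mathcal{D}^c$. Put $T_{\mathcal{D}}=\{i\in[n] : \{i,j\}\in\mathcal{D}\text{ for all }j\in[n]\setminus\{i\}\}$, and let $G_{\mathcal{D}}$ be the simple graph with vertex set $[n]\setminus T_{\mathcal{D}}$ and edge set $\{\{i,j\}\in\mathcal{D} : i,j\in[n]\setminus T_{\mathcal{D}}\}$. For $T\subseteq[n]\setminus T_{\mathcal{D}}$ let - $\mathcal{D}+T=\mathcal{D}\cup\{\{i,j\}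 : i\in T,\ j\in[n]\setminus\{i\}\}$; - $G_{\mathcal{D}}\setminus T$ be the induced subgraph of $G_{\mathcal{D}}$ on $[n]\setminus(T_{\mathcal{D}}\cup T)$ (the graph associated with $\mathcal{D}+T$, with vanishing set $T_{\mathcal{D}}\cup T$); - $c(\mathcal{D}+T)$ be the number of connected components of $G_{\mathcal{D}}\setminus T$ (isolated vertices count as components); - $\overline{\mathcal{D}+T}$ be the union of $\mathcal{D}+T$ with the set of all pairs $\{i,k\}$ of distinct vertices lying in the same connected component of $G_{\mathcal{D}}\setminus T$. Finally $$\mathbb{T}_{\mathcal{D}}=\{T\subseteq[n]\setminus T_{\mathcal{D}} : T=\emptyset\ \text{ or }\ c(\mathcal{D}+T)>c(\mathcal{D}+(T\setminus\{i\}))\text{ for every } i\in T\}.$$ *)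

(* Defs.v *)
From HB Require Import structures.
From mathcomp Require Import all_boot.

Set Implicit Arguments.
Unset Strict Implicit.
Unset Printing Implicit Defensive.

(* The ground set [n] is 'I_n, i.e. {0, ..., n-1}. *)

Definition pairs (n : nat) : {set {set 'I_n}} :=
  [set e : {set 'I_n} | #|e| == 2].

Definition pairC (n : nat) (D : {set {set 'I_n}}) : {set {set 'I_n}} :=
  pairs n :\: D.

Definition is_matroid (n : nat) (M : {set {set 'I_n}}) : bool :=
  [&& M \subset pairs n, M != set0 &
    [forall B1 in M, forall B2 in M, forall b1 in B1 :\: B2,
       exists b2 in B2 :\: B1, (B1 :\ b1) :|: [set b2] \in M]].

Definition Mat (n : nat) (D : {set {set 'I_n}}) : {set {set {set 'I_n}}} :=
  [set M : {set {set 'I_n}} |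
    maxset (fun M' : {set {set 'I_n}} => is_matroid M' && (M' \subset pairC D))
           M].

(* T_D *)
Definition vanishing (n : nat) (D : {set {set 'I_n}}) : {set 'I_n} :=
  [set i : 'I_n | [forall j in [set~ i], [set i; j] \in D]].

(* Adjacency in G_D, whose vertex set is ~: vanishing D; as a relation on all
   of 'I_n it relates no element outside that set. *)
Definition adj (n : nat) (D : {set {set 'I_n}}) : rel 'I_n :=
  fun i j => [&& i \notin vanishing D, j \notin vanishing D, i != j
               & [set i; j] \in D].

(* Vertex set and adjacency of the induced subgraph G_D \ T. *)
Definition del_vertices (n : nat) (D : {set {set 'I_n}}) (T : {set 'I_n}) :
    {set 'I_n} :=
  ~: (vanishing D :|: T).

Definition del_adj (n : nat) (D : {set {set 'I_n}}) (T : {set 'I_n}) :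
    rel 'I_n :=
  fun i j => [&& i \in del_vertices D T, j \in del_vertices D T & adj D i j].

(* n_comp counts connected components only when connectivity is symmetric and
   the vertex set is closed under adjacency. *)
Lemma del_adj_connect_sym (n : nat) (D : {set {set 'I_n}}) (T : {set 'I_n}) :
  connect_sym (del_adj D T).
Proof.
apply: sym_connect_sym => i j; rewrite /del_adj /adj [i == j]eq_sym setUC.
by rewrite andbCA; do 2 congr (_ && _); rewrite andbCA.
Qed.

Lemma del_vertices_closed (n : nat) (D : {set {set 'I_n}}) (T : {set 'I_n}) :
  closed (del_adj D T) (del_vertices D T).
Proof. by move=> i j /and3P[-> ->]. Qed.

(* c(D + T) *)
Definition ncomp (n : nat) (D : {set {set 'I_n}}) (T : {set 'I_n}) : nat :=
  n_comp (del_adj D T) (del_vertices D T).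

(* D + T *)
Definition add_vanishing (n : nat) (D : {set {set 'I_n}}) (T : {set 'I_n}) :
    {set {set 'I_n}} :=
  D :|: [set [set i; j] | i in T, j in [set~ i]].

(* The overlined D + T. *)
Definition add_closure (n : nat) (D : {set {set 'I_n}}) (T : {set 'I_n}) :
    {set {set 'I_n}} :=
  add_vanishing D T :|:
  [set e : {set 'I_n} | [exists i in del_vertices D T,
     exists k in del_vertices D T,
       [&& i != k, connect (del_adj D T) i k & e == [set i; k]]]].

(* The family written with a blackboard-bold T. *)
Definition TT (n : nat) (D : {set {set 'I_n}}) : {set {set 'I_n}} :=
  [set T : {set 'I_n} | (T \subset ~: vanishing D) &&
    ((T == set0) || [forall i in T, ncomp D (T :\ i) < ncomp D T])].

(* Main.v *)
Require Import Defs.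
From mathcomp Require Import all_boot.

(** A rank-2 matroid is determined by its set of loops and the partition of the
    non-loops into parallel classes.  If it avoids [D], its loops contain [T_D]
    and its parallel classes are unions of components of [G_D \ T], where [T] is
    the set of loops outside [T_D]; so it lies in the matroid
    [pairC (add_closure D T)], whose classes are exactly these components.
    Putting [i \in T] back into the graph keeps all the components of [G_D \ T]
    apart exactly when the number of components does not drop, so the maximal
    matroids are those for which every [i \in T] is a genuine cut vertex. *)

Set Implicit Arguments.
Unset Strict Implicit.
Unset Printing Implicit Defensive.

(** * Rank-2 matroids: loops and parallel elements *)

Section MatroidRank2.

Variables (n : nat) (M : {set {set 'I_n}}).
Hypothesis matM : is_matroid M.

Lemma is_matroid_pairs : M \subset pairs n.
Proof. by case/and3P: matM. Qed.

Lemma is_matroid_neq0 : M != set0.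
Proof. by case/and3P: matM. Qed.

Lemma matroid_irrefl (i : 'I_n) : [set i; i] \notin M.
Proof.
apply/negP => /(subsetP is_matroid_pairs).
by rewrite inE cards2 eqxx.
Qed.

Lemma matroid_exchange (B1 B2 : {set 'I_n}) (b1 : 'I_n) :
  B1 \in M -> B2 \in M -> b1 \in B1 :\: B2 ->
  exists2 b2, b2 \in B2 :\: B1 & (B1 :\ b1) :|: [set b2] \in M.
Proof.
move=> B1M B2M b1B; case/and3P: matM => _ _ /forall_inP/(_ _ B1M).
move=> /forall_inP/(_ _ B2M)/forall_inP/(_ _ b1B)/exists_inP[b2 ? ?].
by exists b2.
Qed.

(** The basis [[set j; l]] witnesses that [j] is not a loop. Were [[set i; k]] a basis, exchanging
    [l] out of [[set j; l]] would make [j] a basis with [i] or with [k]. *)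
Lemma parallel_trans (i j k l : 'I_n) :
  [set j; l] \in M -> [set i; j] \notin M -> [set j; k] \notin M ->
  [set i; k] \notin M.
Proof.
move=> jlM ijM jkM; apply/negP => ikM.
have [li|li] := eqVneq l i; first by move: ijM; rewrite setUC -li jlM.
have [lk|lk] := eqVneq l k; first by move: jkM; rewrite -lk jlM.
have ljneq : l != j.
  by apply: contraTneq jlM => ->; exact: matroid_irrefl.
have lB : l \in [set j; l] :\: [set i; k].
  by rewrite !inE eqxx orbT andbT negb_or li lk.
have [b] := matroid_exchange jlM ikM lB.
have -> : [set j; l] :\ l = [set j].
  apply/setP => x; rewrite !inE.
  have [->|] := eqVneq x l; first by rewrite (negbTE ljneq).
  by rewrite orbF.
rewrite !inE => /andP[_ /orP[]/eqP->]; last by rewrite (negbTE jkM).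
by rewrite setUC (negbTE ijM).
Qed.

Definition nonloops : {set 'I_n} := [set i | [exists j, [set i; j] \in M]].

Lemma nonloopsl (i j : 'I_n) : [set i; j] \in M -> i \in nonloops.
Proof. by move=> ijM; rewrite inE; apply/existsP; exists j. Qed.

End MatroidRank2.

(** * Matroids whose parallel classes are the components of a graph *)

Section ComponentMatroid.

Variables (n : nat) (D : {set {set 'I_n}}).
Implicit Types (i j x y : 'I_n) (T : {set 'I_n}) (M : {set {set 'I_n}}).

Notation comp_matroid T := (pairC (add_closure D T)).

Lemma in_del_vertices T i :
  (i \in del_vertices D T) = (i \notin vanishing D) && (i \notin T).
Proof. by rewrite in_setC in_setU negb_or. Qed.

Lemma connect_del_vertices T i j :
  connect (del_adj D T) i j ->
  (i \in del_vertices D T) = (j \in del_vertices D T).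
Proof. by move/(closed_connect (@del_vertices_closed n D T)). Qed.

(** A pair meeting a removed vertex lies in [D] or was added with [T]; for two remaining vertices
    only connectivity matters, since pairs of [D] are edges. The case [i = j] fits in because
    [connect] is reflexive. *)
Lemma mem_comp_matroid T i j :
  ([set i; j] \in comp_matroid T) =
  [&& i \in del_vertices D T, j \in del_vertices D T
    & ~~ connect (del_adj D T) i j].
Proof.
have [->|ij] := eqVneq i j.
  by rewrite connect0 !andbF !inE cards2 eqxx andbF.
have vanD x y : x != y -> x \in vanishing D -> [set x; y] \in D.
  by move=> xy; rewrite inE => /forall_inP; apply; rewrite !inE eq_sym.
have addT x y : x != y -> x \in T ->
    [set x; y] \in [set [set i; j] | i in T, j in [set~ i]].
  by move=> xy xT; apply/imset2P; exists x y; rewrite // !inE eq_sym.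
have outC x y : x != y -> x \notin del_vertices D T ->
    [set x; y] \in add_closure D T.
  rewrite in_del_vertices -negb_or negbK => xy.
  case/orP=> [/(vanD _ _ xy)|/(addT _ _ xy)] xyD;
  by rewrite /add_closure /add_vanishing !in_setU xyD ?orbT.
rewrite in_setD [_ \in pairs n]inE cards2 ij eqxx andbT.
have [iV|iV] := boolP (i \in del_vertices D T); last by rewrite outC.
have [jV|jV] := boolP (j \in del_vertices D T); last first.
  by rewrite setUC outC // eq_sym.
rewrite /=; congr (~~ _); apply/idP/idP; last first.
  move=> cij; rewrite /add_closure in_setU; apply/orP; right; rewrite inE.
  apply/exists_inP; exists i => //; apply/exists_inP; exists j => //.
  by rewrite ij cij eqxx.
have pair_eq x y : [set i; j] = [set x; y] ->
    (x = i /\ y = j) \/ (x = j /\ y = i).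
  move=> /setP e; move: (e i) (e j) (e x) (e y); rewrite !inE !eqxx !orbT.
  move=> /esym/orP[]/eqP exi /esym/orP[]/eqP eyj; subst => //.
  - by rewrite eqxx in ij.
  - by left.
  - by right.
  - by rewrite eqxx in ij.
have /andP[iv iT] : (i \notin vanishing D) && (i \notin T).
  by rewrite -in_del_vertices.
have /andP[jv jT] : (j \notin vanishing D) && (j \notin T).
  by rewrite -in_del_vertices.
rewrite /add_closure /add_vanishing !in_setU.
case/orP=> [/orP[ijD|/imset2P[x y xT _ /pair_eq]]|].
- by apply: connect1; rewrite /del_adj iV jV /adj iv jv ij ijD.
- by case=> -[xE _]; move: xT; rewrite xE ?(negbTE iT) ?(negbTE jT).
rewrite inE => /exists_inP[x xV /exists_inP[y yV /and3P[_ cxy /eqP/pair_eq]]].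
case=> -[xE yE]; move: cxy; rewrite xE yE //.
by rewrite del_adj_connect_sym.
Qed.

Lemma comp_matroidP T i j :
  reflect [/\ i \in del_vertices D T, j \in del_vertices D T
            & ~~ connect (del_adj D T) i j]
          ([set i; j] \in comp_matroid T).
Proof. by rewrite mem_comp_matroid; apply: and3P. Qed.

Lemma comp_matroid_sub_pairs T : comp_matroid T \subset pairs n.
Proof. exact: subsetDl. Qed.

Lemma comp_matroid_sub T : comp_matroid T \subset pairC D.
Proof. by apply: setDS; rewrite /add_closure /add_vanishing -setUA subsetUl. Qed.

Lemma pairs_subP (A B : {set {set 'I_n}}) :
  A \subset pairs n ->
  (forall i j, [set i; j] \in A -> [set i; j] \in B) -> A \subset B.
Proof.
move=> /subsetP Ap AB; apply/subsetP => e eA.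
have /cards2P[x [y [_ eE]]] : #|e| == 2 by have := Ap _ eA; rewrite inE.
by rewrite eE; apply: AB; rewrite -eE.
Qed.

Lemma comp_matroid_neq0P T :
  reflect (exists i j, [set i; j] \in comp_matroid T) (comp_matroid T != set0).
Proof.
apply: (iffP (set0Pn _)) => [[e eB]|[i [j ijB]]]; last by exists [set i; j].
have := subsetP (comp_matroid_sub_pairs T) _ eB.
by rewrite inE => /cards2P[x [y [_ eE]]]; exists x, y; rewrite -eE.
Qed.

(** As [x] and [y] lie in different components, [b] shares a component with at most one of them. *)
Lemma comp_matroid_augment T x y b :
  [set x; y] \in comp_matroid T -> b \in del_vertices D T ->
  exists2 z, z \in [set x; y] & [set z; b] \in comp_matroid T.
Proof.
move=> /comp_matroidP[xV yV nxy] bV.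
have [cxb|nxb] := boolP (connect (del_adj D T) x b); last first.
  by exists x; [rewrite !inE eqxx|apply/comp_matroidP].
exists y; first by rewrite !inE eqxx orbT.
apply/comp_matroidP; split=> //; apply: contra nxy => cyb.
by apply: connect_trans cxb _; rewrite del_adj_connect_sym.
Qed.

(** Exchange amounts to augmenting the remaining element [b] of [B1] by some [z] of [B2]; this [z]
    is new because [a] is not in [B2] and [b] forms no basis with itself. *)
Lemma comp_matroid_is_matroid T :
  comp_matroid T != set0 -> is_matroid (comp_matroid T).
Proof.
move=> B0; apply/and3P; split=> //; first exact: comp_matroid_sub_pairs.
apply/forall_inP => B1 B1M; apply/forall_inP => B2 B2M.
apply/forall_inP => a; rewrite inE => /andP[aB2 aB1].
have := subsetP (comp_matroid_sub_pairs T) _ B1M.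
rewrite inE (cardsD1 a) aB1 eqSS => /cards1P[b B1a].
have B1E : B1 = [set a; b] by rewrite -(setD1K aB1) B1a.
have := subsetP (comp_matroid_sub_pairs T) _ B2M.
rewrite inE => /cards2P[c [d [_ B2E]]].
have bV : b \in del_vertices D T.
  by move: B1M; rewrite B1E => /comp_matroidP[].
have cdM : [set c; d] \in comp_matroid T by rewrite -B2E.
have [z zB2 zbM] := comp_matroid_augment cdM bV.
apply/exists_inP; exists z; last by rewrite B1a setUC.
rewrite in_setD B1E B2E zB2 andbT !inE negb_or; apply/andP; split.
  by apply: contraNneq aB2 => <-; rewrite B2E.
apply: contraTneq zbM => ->.
by apply/negP => /comp_matroidP[_ _]; rewrite connect0.
Qed.

Lemma matroid_sub_comp_matroid M :
  is_matroid M -> M \subset pairC D ->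
  exists2 T : {set 'I_n}, T \subset ~: vanishing D & M \subset comp_matroid T.
Proof.
move=> matM /subsetP MD; pose T := ~: nonloops M :\: vanishing D.
exists T; first by rewrite /T setDE subsetIr.
have MnD e : e \in M -> e \notin D by move/MD; rewrite inE => /andP[].
have VE x : (x \in del_vertices D T) = (x \notin vanishing D) && (x \in nonloops M).
  rewrite in_del_vertices in_setD in_setC.
  by case: (x \in vanishing D); rewrite //= negbK.
(* Induction along a path: each edge is in [D], hence a non-basis, and by the choice of [T] each
   vertex passed is a non-loop, as transitivity of parallelism requires. *)
have connM x y : connect (del_adj D T) x y -> [set x; y] \notin M.
  move=> /connectP[p pP ->] {y}; elim: p x pP => [|y p IHp] x /=.
    by move=> _; exact: matroid_irrefl.
  case/andP=> /and3P[_ yV /and4P[_ _ _ xyD]] /IHp yzM.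
  move: yV; rewrite VE => /andP[_]; rewrite inE => /existsP[l ylM].
  by apply: parallel_trans ylM _ yzM => //; apply: contraL xyD => /MnD.
have inV i j : [set i; j] \in M -> i \in del_vertices D T.
  move=> ijM; rewrite VE (nonloopsl ijM) andbT.
  apply: contraL (ijM) => /[!inE] /forall_inP iD; apply: contraL (iD j _).
    exact: MnD.
  rewrite !inE; apply: contraTneq ijM => ->; exact: matroid_irrefl.
apply: pairs_subP (is_matroid_pairs matM) _ => i j ijM.
apply/comp_matroidP; split; first exact: inV ijM.
  by apply: (inV j i); rewrite setUC.
by apply: contraL ijM => /connM.
Qed.

(** * Effect of shrinking [T] on loops and on the number of components *)

Lemma del_verticesS T T' :
  T' \subset T -> del_vertices D T \subset del_vertices D T'.
Proof. by move=> sT; rewrite setCS setUS. Qed.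

Lemma connect_del_adjS T T' :
  T' \subset T -> subrel (connect (del_adj D T)) (connect (del_adj D T')).
Proof.
move=> /del_verticesS/subsetP sV; apply: connect_sub => x y /and3P[xV yV xy].
by apply: connect1; rewrite /del_adj !sV.
Qed.

(** Once there is a basis, augmentation puts every vertex outside [T] into some basis; that basis
    survives for [T'], so the vertex is outside [T'] as well. *)
Lemma comp_matroid_sub_loops T T' :
  T' \subset ~: vanishing D -> comp_matroid T != set0 ->
  comp_matroid T \subset comp_matroid T' -> T' \subset T.
Proof.
move=> /subsetP T'v /comp_matroid_neq0P[x [y xyM]] /subsetP sM.
apply/subsetP => i iT'; apply: contraLR (iT') => iT.
have iV : i \in del_vertices D T.
  by rewrite in_del_vertices iT andbT -in_setC T'v.
have [z _ /sM /comp_matroidP[_]] := comp_matroid_augment xyM iV.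
by rewrite in_del_vertices => /andP[].
Qed.

(** One canonical vertex per component, so that numbers of components are compared through maps
    between sets of roots. *)
Definition comp_roots T : {set 'I_n} :=
  [set x in del_vertices D T | roots (del_adj D T) x].

Lemma in_comp_roots T x :
  (x \in comp_roots T) = (x \in del_vertices D T) && roots (del_adj D T) x.
Proof. by rewrite inE. Qed.

Lemma ncompE T : ncomp D T = #|comp_roots T|.
Proof.
by apply: eq_card => x; rewrite in_comp_roots [LHS]andbC.
Qed.

Lemma root_comp_roots T x :
  x \in del_vertices D T -> root (del_adj D T) x \in comp_roots T.
Proof.
rewrite in_comp_roots -(connect_del_vertices (connect_root _ x)) => ->.
exact/roots_root/del_adj_connect_sym.
Qed.

(** Inclusion of the bases says that distinct components for [T] stay distinct in the larger graph,
    so taking roots there is injective on [comp_roots T]. *)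
Lemma leq_ncomp T T' :
  comp_matroid T \subset comp_matroid T' ->
  T' \subset T -> ncomp D T <= ncomp D T'.
Proof.
move=> /subsetP sM sT; have /subsetP sV := del_verticesS sT.
have sym := @del_adj_connect_sym n D.
rewrite !ncompE.
have inj : {in comp_roots T &, injective (root (del_adj D T'))}; last first.
  rewrite -(card_in_imset inj); apply/subset_leq_card/subsetP => _ /imsetP[x + ->].
  by rewrite in_comp_roots => /andP[/sV/root_comp_roots].
move=> x y; rewrite !in_comp_roots => /andP[xV /eqP xr] /andP[yV /eqP yr] /eqP.
rewrite root_connect // => cxy.
rewrite -xr -yr; apply/eqP; rewrite root_connect //.
apply: contraLR (cxy) => nxy.
have /sM/comp_matroidP[] // : [set x; y] \in comp_matroid T.
exact/comp_matroidP.
Qed.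

(** A lost basis means that restoring [i] merges two components. Taking new roots then sends the old
    roots onto the new ones, but not injectively. *)
Lemma ltn_ncomp T i :
  i \in T -> ~~ (comp_matroid T \subset comp_matroid (T :\ i)) ->
  ncomp D (T :\ i) < ncomp D T.
Proof.
move=> iT nsub; set T' := T :\ i in nsub *.
have sT : T' \subset T by exact: subsetDl.
have /subsetP sV := del_verticesS sT.
have sym := @del_adj_connect_sym n D.
have V'E x : x \in del_vertices D T' -> x != i -> x \in del_vertices D T.
  by rewrite !in_del_vertices in_setD1 => /andP[-> +] xi; rewrite xi.
have [x [y [xV yV nxy cxy]]] : exists x y, [/\ x \in del_vertices D T,
    y \in del_vertices D T, ~~ connect (del_adj D T) x y
    & connect (del_adj D T') x y].
  move: nsub => /subsetPn[e eM eM'].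
  have /cards2P[x [y [_ eE]]] : #|e| == 2.
    by have := subsetP (comp_matroid_sub_pairs T) _ eM; rewrite inE.
  subst e; case/comp_matroidP: eM => xV yV nxy.
  exists x, y; split=> //; apply: contraNT eM' => nxy'.
  by apply/comp_matroidP; split; [exact: sV|exact: sV|].
(* Otherwise [i] would return as an isolated vertex, and [x] and [y] would already be connected
   without it. *)
have [w wV cwi] : exists2 w, w \in del_vertices D T & connect (del_adj D T') w i.
  case: (pickP [pred w in del_vertices D T | connect (del_adj D T') w i]).
    by move=> w /andP[]; exists w.
  move=> noW; case/negP: nxy; apply: connect_sub cxy => a b.
  move=> abE; case/and3P: (abE) => aV' bV' ab.
  have ab_neq : a != b by case/and4P: ab.
  have [ai|ai] := eqVneq a i.
    have := noW b; rewrite inE /= V'E // -?ai 1?eq_sym //=.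
    by rewrite sym connect1.
  have [bi|bi] := eqVneq b i.
    by have := noW a; rewrite inE /= V'E // -?bi //= connect1.
  by apply: connect1; rewrite /del_adj !V'E.
have rootr z : root (del_adj D T') (root (del_adj D T) z) = root (del_adj D T') z.
  apply/eqP; rewrite root_connect // sym.
  exact: connect_del_adjS sT _ _ (connect_root _ z).
have ltT : #|root (del_adj D T') @: comp_roots T| < #|comp_roots T|.
  rewrite ltn_neqAle leq_imset_card andbT; apply: contra nxy => /imset_injP inj.
  rewrite -root_connect //; apply/eqP/inj; rewrite ?root_comp_roots // !rootr.
  by apply/eqP; rewrite root_connect.
rewrite !ncompE; apply: leq_ltn_trans ltT; apply/subset_leq_card/subsetP => z.
rewrite in_comp_roots => /andP[zV' /eqP zr].
(* A new root comes from its own old root, except that [i] has no component in the old graph and is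
   reached through [w]. *)
have [zi|zi] := eqVneq z i; apply/imsetP.
  exists (root (del_adj D T) w); first exact: root_comp_roots.
  by rewrite rootr -zr zi; apply/eqP; rewrite root_connect // sym.
by exists (root (del_adj D T) z); rewrite ?rootr ?zr ?root_comp_roots ?V'E.
Qed.

End ComponentMatroid.

(** * Maximality of the component matroids *)

Theorem proposition3p13 (n : nat) (hn : 2 <= n) (D : {set {set 'I_n}})
    (hD : D \subset pairs n) :
  Mat D =
  [set pairC (add_closure D T) | T in TT D & pairC (add_closure D T) != set0].
Proof.
apply/setP => M; rewrite inE; apply/maxsetP/imsetP.
  case=> /andP[matM MD] maxM.
  have [T Tv sM] := matroid_sub_comp_matroid matM MD.
  have neq0S T' : M \subset pairC (add_closure D T') ->
      pairC (add_closure D T') != set0.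
    move=> sMT; apply: contraNneq (is_matroid_neq0 matM) => B0.
    by rewrite -subset0 -B0.
  have eqM T' : M \subset pairC (add_closure D T') ->
      pairC (add_closure D T') = M.
    move=> sMT; refine (maxM _ _ sMT).
    apply/andP; split; last exact: comp_matroid_sub.
    exact: comp_matroid_is_matroid (neq0S _ sMT).
  have ME := eqM _ sM.
  exists T; last by [].
  rewrite inE; apply/andP; split; last exact: neq0S sM.
  rewrite inE Tv; apply/orP; right; apply/forall_inP => i iT.
  apply: (ltn_ncomp iT); apply/negP => /(subset_trans sM) sMi.
  (* If restoring [i] lost no basis, maximality would make the matroids of [T :\ i] and [T] both
     equal to [M], and comparing loops would remove [i] from [T]. *)
  have : T \subset T :\ i.
    apply: (comp_matroid_sub_loops Tv (neq0S _ sMi)).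
    by have := sM; rewrite -{1}(eqM _ sMi).
  by move/subsetP/(_ _ iT); rewrite in_setD1 eqxx.
case=> T; rewrite inE => /andP[TTD M0] ->.
have {TTD} /andP[Tv TTD] : (T \subset ~: vanishing D) &&
    ((T == set0) || [forall i in T, ncomp D (T :\ i) < ncomp D T]).
  by move: TTD; rewrite inE.
split.
  by apply/andP; split; [exact: comp_matroid_is_matroid|exact: comp_matroid_sub].
move=> N /andP[matN ND] sN.
have [T' T'v sNT'] := matroid_sub_comp_matroid matN ND.
have sTT' := subset_trans sN sNT'.
have T'T : T' \subset T.
  exact: comp_matroid_sub_loops sTT'.
(* [N] is squeezed between the matroids of [T] and [T']. *)
suff TE : T = T' by apply/eqP; rewrite eqEsubset sN andbT TE.
apply/eqP; rewrite eqEsubset T'T andbT; apply/subsetP => i iT.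
apply: contraLR (iT) => iT'; move: TTD.
have [->|_ /=] := eqVneq T set0; first by rewrite inE.
move=> /forall_inP/(_ _ iT); rewrite ltnNge => /negP[].
(* The graph for [T :\ i] lies between those for [T] and [T']. Components for [T] that stay apart
   for [T'] stay apart there too, so deleting [i] could not have raised the count. *)
have T'Ti : T' \subset T :\ i by rewrite subsetD1 T'T.
apply: leq_ncomp; last exact: subsetDl.
apply: pairs_subP (comp_matroid_sub_pairs D T) _ => x y xyM.
have /comp_matroidP[_ _ nxy] := subsetP sTT' _ xyM.
case/comp_matroidP: xyM => xV yV _; apply/comp_matroidP.
have /subsetP sV := del_verticesS D (subsetDl T [set i]).
split; [exact: sV|exact: sV|].
by apply: contra nxy; apply: connect_del_adjS.
Qed.
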